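(* Let $p$ be a prime, let $U$ be a powerful finite $p$-group, and let $d, f \ge 1$ be integers. If there is a surjective homomorphism $U \to C_{p^{2f}}^d$, then $U$ has a subgroup isomorphic to $C_{p^f}^d$.
   Context: $C_k$ denotes the cyclic group of order $k$ and $C_k^d$ the direct product of $d$ copies of $C_k$. For a finite $p$-group $G$ and an integer $e \ge 0$, $\mho_e(G) = \langle x^{p^e} : x \in G\rangle$ is the subgroup generated by all $p^e$-th powers. A finite $p$-group $G$ is powerful if $G/\mho_1(G)$ is abelian when $p$ is odd, and if $G/\mho_2(G)$ is abelian when $p = 2$. *)

(* Defs.v *)
From mathcomp Require Import all_boot all_fingroup zmodp all_solvable.

Set Implicit Arguments.
Unset Strict Implicit.
Unset Printing Implicit Defensive.

Import GroupScope.

(* ['Mho^n(G)] restricts its generators to elements of prime-power order; when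
   [G] is a p-group it is the subgroup generated by all p^n-th powers of
   elements of [G] (lemma [MhoE]). *)
Definition powerful (gT : finGroupType) (p : nat) (G : {group gT}) : bool :=
  abelian (G / 'Mho^(if p == 2 then 2 else 1)%N(G)).

(* [Zp k] (all of ['Z_k] if [1 < k], the trivial subgroup if [k = 1]) is the
   cyclic group of order [k] for every [0 < k]; [setXn] is the external direct
   product with componentwise law. *)
Definition cyclic_power (k d : nat) : {group {dffun 'I_d -> 'Z_k}} :=
  [group of setXn (fun _ : 'I_d => Zp k)].

(* Main.v *)
Require Import Defs.
From mathcomp Require Import all_boot all_fingroup zmodp all_solvable.

(* Write U_i for the group generated by the p^i-th powers of the powerful group
   U; U_i is the set of p^i-th powers, and [U_i, U_j] <= U_(i+j+1) (i+j+2 when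
   p = 2).  The crux is a commutation law: if x^(p^(n+1)) = 1 and y^(p^n) = 1,
   then x^(p^i) and y^(p^j) commute as soon as i + j = n.  It is trivial for
   i = 0 and is carried from (i, j+1) to (i+1, j) through the commutator c of
   X = x^(p^i) and Y = y^(p^j): expanding (Y^X)^p = Y^p and (X^Y)^p shows that
   c^p = 1 and then that X^p commutes with Y, provided the error terms [c, Y]
   and [c, X] are harmless.  They are, by the same law for n + 1 (a downward
   induction on n, void for large n) together with c^p in U_e, where U_(e+1) = 1
   (an upward induction on e, through U / U_e).

   Consequently the elements of order dividing p^f in U_f form an abelian group
   A.  An induction on e also gives |Ohm_1(U_m)| >= |U_m : U_(m+1)| for m > 0,
   so the image C_(p^(2f))^d of U forces |Ohm_1(U_(2f-1))| >= p^d; every element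
   of that group is a p^(f-1)-th power in A, so the structure theorem provides d
   independent cyclic factors of order p^f in A. *)

Set Implicit Arguments.
Unset Strict Implicit.
Unset Printing Implicit Defensive.

Import GroupScope.

(** * Powerful p-groups *)

(* In a powerful p-group U, [U_i, U_j] <= U_(i + j + pow_gap p). *)
Definition pow_gap (p : nat) : nat := if p == 2 then 2 else 1%N.

(** Since [x ^ y = x * [~ x, y]], this is the class-two expansion of the n-th power of [x *
    [~ x, y]]. *)
Lemma commXg_bin {gT : finGroupType} (n : nat) (x y : gT) :
    commute x [~ [~ x, y], x] -> commute [~ x, y] [~ [~ x, y], x] ->
  [~ x ^+ n, y] = [~ x, y] ^+ n * [~ [~ x, y], x] ^+ 'C(n, 2).
Proof.
move=> cxz cyz.
by rewrite {1}/commg conjXg conjg_mulR expMg_Rmul // -mulgA mulKg.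
Qed.

Lemma Mho_exp {p : nat} {gT : finGroupType} (n : nat) {G : {group gT}} {x} :
  p.-group G -> x \in G -> x ^+ (p ^ n) \in 'Mho^n(G).
Proof. by move=> pG Gx; rewrite Mho_p_elt ?(mem_p_elt pG). Qed.

Lemma Mho_sub_exp {p : nat} {gT : finGroupType} (n : nat) {G H : {group gT}} :
    p.-group G -> (forall x, x \in G -> x ^+ (p ^ n) \in H) ->
  'Mho^n(G) \subset H.
Proof.
move=> pG GH; rewrite (MhoE n pG) gen_subG.
by apply/subsetP=> _ /imsetP[x Gx ->]; apply: GH.
Qed.

Lemma sub_Mho_Mho {p : nat} {gT : finGroupType} (m n : nat) {G : {group gT}} :
  p.-group G -> 'Mho^(m + n)(G) \subset 'Mho^n('Mho^m(G)).
Proof.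
move=> pG; apply: (Mho_sub_exp (p := p)) => // x Gx.
rewrite expnD expgM; apply: Mho_exp; last exact: Mho_exp.
by rewrite (pgroupS (Mho_sub _ _)).
Qed.

Lemma dvdn_bin2 (p : nat) : prime p -> p != 2 -> p %| 'C(p, 2).
Proof.
move=> p_pr p'2; apply: prime_dvd_bin => //=.
by rewrite ltn_neqAle eq_sym p'2 prime_gt1.
Qed.

(** * Powerfully embedded subgroups *)

Section PowerfullyEmbedded.

Variables (p : nat) (gT : finGroupType) (G N : {group gT}).
Hypotheses (p_pr : prime p) (pG : p.-group G) (nNG : N <| G).

Let pN : p.-group N. Proof. exact: pgroupS (normal_sub nNG) pG. Qed.
Let pM : p.-group 'Mho^1(N). Proof. exact: pgroupS (Mho_sub _ _) pN. Qed.
Let nMG : 'Mho^1(N) <| G. Proof. exact: gFnormal_trans. Qed.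

(** Modulo [K] the generators of ['Mho^n(N)] are central, hence so is the group they generate. *)
Lemma commg_Mho_sub (n : nat) (K : {group gT}) :
    K <| G -> (forall x g, x \in N -> g \in G -> [~ x ^+ (p ^ n), g] \in K) ->
  [~: 'Mho^n(N), G] \subset K.
Proof.
case/andP=> _ nKG NK.
have sNG := subset_trans (Mho_sub n N) (normal_sub nNG).
have nK x : x \in G -> x \in 'N(K) by apply: subsetP.
have nKN := subset_trans sNG nKG.
rewrite -quotient_cents2 // sub_quotient_pre //.
apply: (Mho_sub_exp (p := p)) => // x Nx.
have Gx : x \in G by rewrite (subsetP (normal_sub nNG)).
rewrite mem_morphpre ?nK ?groupX //; apply/centP=> _ /morphimP[g _ Gg ->].
apply/commgP; rewrite -morphR ?nK ?groupX //= coset_id //.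
exact: NK.
Qed.

(* The triviality and centrality assumptions are met after passing to the
   quotient of G by Mho^(pow_gap p)(Mho^1(N)) * [Mho^1(N), G, G]. *)
Lemma commg_Mho1_central_odd :
    p != 2 -> [~: N, G] \subset 'Mho^1(N) -> 'Mho^1('Mho^1(N)) = 1 ->
    [~: 'Mho^1(N), G] \subset 'Z(G) ->
  [~: 'Mho^1(N), G] = 1.
Proof.
move=> p'2 sNG tM sZ; apply/trivgP.
apply: (commg_Mho_sub (normal1 _)) => x g Nx Gg; apply/set1P.
have Gx := subsetP (normal_sub nNG) x Nx.
have My : [~ x, g] \in 'Mho^1(N) by rewrite (subsetP sNG) ?mem_commg.
have Zz : [~ [~ x, g], x] \in 'Z(G) by rewrite (subsetP sZ) ?mem_commg.
have Mz : [~ [~ x, g], x] \in 'Mho^1(N).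
  apply: (subsetP (_ : [~: 'Mho^1(N), G] \subset _)); last exact: mem_commg.
  by rewrite commg_subl normal_norm.
have cz y : y \in G -> commute y [~ [~ x, g], x].
  by move=> Gy; case/centerP: Zz => _ cG; apply/esym/cG.
have eM y : y \in 'Mho^1(N) -> y ^+ p = 1.
  by move=> yM; apply/set1P; rewrite -[[set 1]]tM -(expn1 p) Mho_exp.
rewrite expn1 commXg_bin; [|exact: cz|by apply: cz; rewrite groupR].
rewrite eM // mul1g.
by case/dvdnP: (dvdn_bin2 p_pr p'2) => k ->; rewrite mulnC expgM eM // expg1n.
Qed.

(** As ['C(2, 2)] is 1, the error term [[~ [~ x, g], x]] survives; it lies in [[~: 'Mho^2(N), G]],
    which is shown to be inside ['Mho^1(E)]. *)
Lemma commg_Mho1_central_two :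
    p = 2 -> [~: N, G] \subset 'Mho^2(N) -> 'Mho^2('Mho^1(N)) = 1 ->
    [~: 'Mho^1(N), G] \subset 'Z(G) ->
  [~: 'Mho^1(N), G] = 1.
Proof.
move=> p2 sNG tM sZ; pose E := [~: 'Mho^1(N), G]%G; pose K := 'Mho^1(E)%G.
have sMG := normal_sub nMG.
have pE : p.-group E by apply: pgroupS pG; rewrite comm_subG.
have cEE : abelian E by apply: abelianS sZ (center_abelian G).
have nEG : E <| G.
  by rewrite /normal comm_subG //= commg_normr.
have nKG : K <| G by apply: gFnormal_trans.
have Zc m g : m \in 'Mho^1(N) -> g \in G -> [~ m, g] \in 'Z(G).
  by move=> Mm Gg; rewrite (subsetP sZ) ?mem_commg.
have cz m g y : m \in 'Mho^1(N) -> g \in G -> y \in G -> commute y [~ m, g].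
  by move=> Mm Gg Gy; case/centerP: (Zc _ _ Mm Gg) => _ cG; apply/esym/cG.
have Mc m g : m \in 'Mho^1(N) -> g \in G -> [~ m, g] \in 'Mho^1(N).
  move=> Mm Gg; apply: (subsetP (_ : [~: 'Mho^1(N), G] \subset _)).
    by rewrite commg_subl normal_norm.
  exact: mem_commg.
have eM m : m \in 'Mho^1(N) -> m ^+ 4 = 1.
  by move=> Mm; apply/set1P; have := Mho_exp 2 pM Mm; rewrite tM p2.
have sqM a : a \in N -> a ^+ 2 \in 'Mho^1(N).
  by move=> Na; have := Mho_exp 1 pN Na; rewrite p2.
have [sNGG sAM] : N \subset G /\ 'Mho^2(N) \subset 'Mho^1(N).
  by rewrite (normal_sub nNG) Mho_leq.
(* The generators are squares of elements a, b of ['Mho^1(N)]; they commute because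
   [[~ a ^+ 2, b ^+ 2] = [~ a, b] ^+ 4 = 1], and [a ^+ 4 = 1]. *)
have eA y : y \in 'Mho^2(N) -> y ^+ 2 = 1.
  have cS : abelian [set a ^+ (p ^ 2) | a in N].
    apply/centsP=> _ /imsetP[a Na ->] _ /imsetP[b Nb ->]; apply/commgP.
    rewrite p2 !(expgM _ 2 2); move: (a ^+ 2) (b ^+ 2) (sqM a Na) (sqM b Nb).
    move=> {Na Nb}a {}b Ma Mb.
    have [Ga Gb] := (subsetP sMG _ Ma, subsetP sMG _ Mb).
    rewrite commXg; last by apply: cz; rewrite ?groupX.
    rewrite commgX; last exact: cz.
    by rewrite -expgM; apply/eqP/eM/Mc.
  rewrite (MhoE 2 pN); move: y; apply/exponentP.
  rewrite abelian_exponent_gen //; apply/exponentP=> _ /imsetP[a Na ->].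
  by rewrite p2 (expgM a 2 2) -(expgM (a ^+ 2)); apply: eM (sqM a Na).
have sAK : [~: 'Mho^2(N), G] \subset K.
  apply: commg_Mho_sub => // a g Na Gg.
  have Ma := sqM a Na; rewrite p2 (expgM a 2 2) commXg; last first.
    by apply: cz => //; apply: (subsetP sMG).
  by have := Mho_exp 1 pE (mem_commg Ma Gg); rewrite p2.
(* The central group E lies in its own Frattini subgroup, hence is trivial. *)
have sEK : E \subset K.
  apply: commg_Mho_sub => // x g Nx Gg.
  have Ay : [~ x, g] \in 'Mho^2(N) by rewrite (subsetP sNG) ?mem_commg.
  have Gx := subsetP sNGG x Nx; have My := subsetP sAM _ Ay.
  rewrite p2 expn1 commXg_bin; [|exact: cz|by apply: cz => //; rewrite groupR].
  rewrite eA // mul1g.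
  by rewrite (subsetP sAK) ?mem_commg.
apply/eqP; apply: contraLR sEK => ntE.
by have := Phi_proper ntE; rewrite (Phi_Mho pE cEE) => /proper_subn.
Qed.

Lemma commg_Mho1_central :
    [~: N, G] \subset 'Mho^(pow_gap p)(N) ->
    'Mho^(pow_gap p)('Mho^1(N)) = 1 ->
    [~: 'Mho^1(N), G] \subset 'Z(G) ->
  [~: 'Mho^1(N), G] = 1.
Proof.
rewrite /pow_gap; case: eqP => [/commg_Mho1_central_two | /eqP] //.
exact: commg_Mho1_central_odd.
Qed.

End PowerfullyEmbedded.

(** Otherwise [A / B] would be a nontrivial normal subgroup of the nilpotent group [G / B] contained
    in its own commutator with [G / B]. *)
Lemma sub_nilpotent_comm (gT : finGroupType) (G A B : {group gT}) :
    nilpotent G -> A <| G -> B <| G -> A \subset B * [~: A, G] -> A \subset B.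
Proof.
move=> nilG /andP[sAG nAG] /andP[sBG nBG] sAB.
have nBA := subset_trans sAG nBG.
rewrite -quotient_sub1 //; apply: contraLR sAB; rewrite subG1 => ntA.
have prA : [~: A / B, G / B] \proper A / B.
  apply: (nil_comm_properl (quotient_nil B nilG)) => //.
    exact: quotientS.
  by rewrite subsetI subxx quotient_norms.
apply: contra (proper_subn prA) => sAB.
by have := quotientS B sAB; rewrite quotientMidl quotientR.
Qed.

Lemma quotient_Mho (n : nat) (gT : finGroupType) (G H : {group gT}) :
  G \subset 'N(H) -> 'Mho^n(G) / H = 'Mho^n(G / H).
Proof. exact: morphim_Mho. Qed.

(** By nilpotency the inclusion need only hold modulo [[~: [~: M, G], G]]. Dividing by [L] makes
    [[~: M, G]] central and ['Mho^(pow_gap p)(M)] trivial, as [commg_Mho1_central] requires. *)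
Lemma commg_Mho1 (p : nat) (gT : finGroupType) (G N : {group gT}) :
    prime p -> p.-group G -> N <| G -> [~: N, G] \subset 'Mho^(pow_gap p)(N) ->
  [~: 'Mho^1(N), G] \subset 'Mho^(pow_gap p)('Mho^1(N)).
Proof.
move=> p_pr pG nNG sNG; set M := 'Mho^1(N)%G.
have nMG : M <| G by apply: gFnormal_trans.
have nEG : [~: M, G] <| G by rewrite /normal comm_subG ?commg_normr ?normal_sub.
have nBG : 'Mho^(pow_gap p)(M) <| G by apply: gFnormal_trans.
have nE2G : [~: [~: M, G], G] <| G.
  by rewrite /normal comm_subG ?commg_normr ?normal_sub.
apply: (sub_nilpotent_comm (pgroup_nil pG)) => //=.
set K := 'Mho^(pow_gap p)(M) * _.
have eK : K = 'Mho^(pow_gap p)(M) <*> [~: [~: M, G], G].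
  by rewrite norm_joinEr // (subset_trans (normal_sub nE2G)) ?normal_norm.
pose L := ('Mho^(pow_gap p)(M) <*> [~: [~: M, G], G])%G.
have nLG : L <| G by rewrite normalY.
have nL := normal_norm nLG.
have nLN := subset_trans (normal_sub nNG) nL.
have nLM := subset_trans (normal_sub nMG) nL.
have nLE := subset_trans (normal_sub nEG) nL.
rewrite eK -[_ <*> _]/(gval L) -quotient_sub1 //.
have eML : M / L = 'Mho^1(N / L) := quotient_Mho 1 nLN.
have eM n : 'Mho^n('Mho^1(N / L)) = 'Mho^n(M) / L.
  by rewrite quotient_Mho // -eML.
have [pGL nNGL] := (quotient_pgroup L pG, quotient_normal L nNG).
have sNGL : [~: N / L, G / L] \subset 'Mho^(pow_gap p)(N / L).
  by rewrite -quotientR // -quotient_Mho // quotientS.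
have tML : 'Mho^(pow_gap p)('Mho^1(N / L)) = 1.
  by rewrite eM quotientS1 // joing_subl.
have cML : [~: 'Mho^1(N / L), G / L] \subset 'Z(G / L).
  rewrite -eML -quotientR // subsetI; apply/andP; split.
    exact: quotientS (normal_sub nEG).
  by rewrite quotient_cents2 // joing_subr.
by rewrite quotientR //= eML (commg_Mho1_central p_pr pGL).
Qed.

Lemma powerfulE (p : nat) (gT : finGroupType) (U : {group gT}) :
  powerful p U = ([~: U, U] \subset 'Mho^(pow_gap p)(U)).
Proof.
by rewrite /powerful /abelian quotient_cents2 // normal_norm ?Mho_normal.
Qed.

Lemma pow_gap_gt0 (p : nat) : 0 < pow_gap p.
Proof. by rewrite /pow_gap; case: ifP. Qed.

(** * Extracting p-th roots in a powerful group *)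

Lemma Mho1_multiplicative (p : nat) (gT : finGroupType) (G : {group gT}) :
    p.-group G -> {in G &, {morph (fun x => x ^+ p) : x y / x * y}} ->
  'Mho^1(G) = [set x ^+ p | x in G].
Proof.
move=> pG powM; rewrite (MhoE 1 pG) expn1 gen_set_id //.
apply/group_setP; split; first by apply/imsetP; exists 1; rewrite ?expg1n.
move=> _ _ /imsetP[x Gx ->] /imsetP[y Gy ->].
by rewrite -powM //; apply: imset_f; rewrite groupM.
Qed.

Lemma cosetM_id (gT : finGroupType) (K : {group gT}) (x y : gT) :
    x \in 'N(K) -> y \in 'N(K) -> coset K x = coset K y ->
  x^-1 * y \in K.
Proof.
move=> Nx Ny exy; rewrite coset_idr ?groupM ?groupV //.
by rewrite morphM ?groupV // morphV //= exy mulVg.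
Qed.

(** Modulo [K] commutators are central and the error term [[~ y, x] ^+ 'C(p, 2)] vanishes, so taking
    p-th powers is multiplicative on [U / K]. *)
Lemma powerful_Mho1_approx (p : nat) (gT : finGroupType) (U : {group gT}) g :
    prime p -> p.-group U -> powerful p U -> g \in 'Mho^1(U) ->
  exists2 x, x \in U & x ^- p * g \in 'Mho^1('Mho^1(U)).
Proof.
move=> p_pr pU; rewrite powerfulE => pwU Mg; set K := 'Mho^1('Mho^1(U))%G.
have nKU : U \subset 'N(K) by rewrite normal_norm // !gFnormal_trans.
have sUM : [~: U, U] \subset 'Mho^1(U).
  by rewrite (subset_trans pwU) // Mho_leq // pow_gap_gt0.
have cMU : [~: 'Mho^1(U), U] \subset K.
  have := commg_Mho1 p_pr pU (normal_refl U) pwU.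
  by move/subset_trans; apply; rewrite Mho_leq // pow_gap_gt0.
have pM : p.-group 'Mho^1(U) by apply: pgroupS pU; apply: Mho_sub.
have powM : {in U / K &, {morph (fun x => x ^+ p) : x y / x * y}}.
  move=> _ _ /morphimP[x Nx Ux ->] /morphimP[y Ny Uy ->] /=.
  have Mc : [~ y, x] \in 'Mho^1(U) by rewrite (subsetP sUM) ?mem_commg.
  have cc z : z \in U -> commute (coset K z) [~ coset K y, coset K x].
    move=> Uz; have Nz := subsetP nKU z Uz.
    apply/commute_sym/commgP; rewrite -!morphR ?groupR //= coset_id //.
    by rewrite (subsetP cMU) ?mem_commg.
  rewrite expMg_Rmul; [|exact: cc|exact: cc].
  rewrite -[RHS]mulg1; congr (_ * _).
  rewrite -morphR // -morphX ?groupR //= coset_id //.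
  have [p2 | p'2] := eqVneq p 2.
    rewrite p2 expg1 (subsetP (sub_Mho_Mho 1 1 pU)) //.
    by have := subsetP pwU [~ y, x] (mem_commg Uy Ux); rewrite /pow_gap p2.
  case/dvdnP: (dvdn_bin2 p_pr p'2) => k ->; rewrite mulnC expgM groupX //.
  by rewrite -[p in _ ^+ p]expn1 Mho_exp.
have pUK := quotient_pgroup K pU.
have : coset K g \in 'Mho^1(U / K).
  by rewrite -(quotient_Mho 1 nKU) mem_quotient.
rewrite (Mho1_multiplicative pUK powM) => /imsetP[_ /morphimP[x Nx Ux ->]].
have Ng := subsetP (subset_trans (Mho_sub 1 U) nKU) g Mg.
rewrite -morphX // => /esym/cosetM_id => Kxg; exists x => //.
by apply: Kxg; rewrite ?groupX.
Qed.

Lemma powerful_Mho1_root (p : nat) (gT : finGroupType) (U : {group gT}) g :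
    prime p -> p.-group U -> powerful p U -> g \in 'Mho^1(U) ->
  exists2 x, x \in U & g = x ^+ p.
Proof.
move=> p_pr; elim: {U}_.+1 {-2}U (ltnSn #|U|) => // m IH U leUm pU pwU Mg.
have [x Ux Kxg] := powerful_Mho1_approx p_pr pU pwU Mg.
(* g is a p-th power in the powerful group <x>M, which is proper unless U is
   cyclic. *)
set M := 'Mho^1(U)%G in Kxg; pose H := (<[x]> <*> M)%G.
have sxU : <[x]> \subset U by rewrite cycle_subG.
have sMU : M \subset U := Mho_sub 1 U.
have sMH : M \subset H := joing_subr _ _.
have sHU : H \subset U by rewrite join_subG sxU.
have pH := pgroupS sHU pU.
have Hg : g \in 'Mho^1(H).
  rewrite -(mulKVg (x ^+ p) g) groupM //; last exact: (subsetP (MhoS 1 sMH)).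
  by rewrite -(expn1 p) Mho_exp // mem_gen // inE cycle_id.
have [sUH | ltHU] := boolP (U \subset H).
  (* [M] lies in the Frattini subgroup of [U], so [x] alone generates [U]. *)
  have eU : <[x]> = U.
    apply: Phi_nongen; apply/eqP.
    rewrite eqEsubset join_subG Phi_sub sub1set Ux /=.
    rewrite (subset_trans sUH) // join_subG cycle_subG.
    rewrite mem_gen /= ?inE ?eqxx ?orbT //=.
    by rewrite (subset_trans _ (joing_subl _ _)) // (Phi_joing pU) joing_subr.
  have: g \in 'Mho^1(<[x]>) by rewrite eU.
  rewrite (Mho_p_cycle 1 (mem_p_elt pU Ux)) expn1 => /cycleP[k ->].
  by exists (x ^+ k); rewrite ?groupX // -!expgM mulnC.
have{} ltHU : H \proper U by rewrite properE sHU.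
have [] // := IH H _ pH _ Hg;
  last by move=> y Hy ->; exists y => //; apply: (subsetP sHU).
  by rewrite -ltnS (leq_trans _ leUm) // ltnS proper_card.
(* Modulo [[~: M, U]] the group [H] is generated by a cyclic group and the central image of [M]; so
   [[~: H, H]] lies in [[~: M, U]], hence in ['Mho^(pow_gap p)(M)]. *)
move: pwU; rewrite !powerfulE => pwU.
have cMU := commg_Mho1 p_pr pU (normal_refl U) pwU.
have nRU : U \subset 'N([~: M, U]) by rewrite commg_normr.
have sRH : [~: M, U] \subset 'Mho^(pow_gap p)(H).
  by rewrite (subset_trans cMU) // MhoS.
apply: subset_trans sRH.
have [nRx nRM nRH] : [/\ <[x]> \subset 'N([~: M, U]),
  M \subset 'N([~: M, U]) & H \subset 'N([~: M, U])].
  by split; apply: subset_trans nRU.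
rewrite -quotient_cents2 // -[_ \subset _]/(abelian (H / _)) quotientY //.
rewrite abelianY quotient_abelian ?cycle_abelian //= /abelian.
rewrite !quotient_cents2 // commGC; apply/andP; split.
  exact: commgS.
by rewrite commGC commgS.
Qed.

Lemma commXg_mod (gT : finGroupType) (K : {group gT}) (n : nat) (x y : gT) :
    x \in 'N(K) -> y \in 'N(K) ->
    [~ [~ x, y], x] \in K -> [~ x, y] ^+ n \in K ->
  [~ x ^+ n, y] \in K.
Proof.
move=> Nx Ny Kxyx Kxyn; have Nxy := groupR Nx Ny.
apply: coset_idr; first by rewrite groupR ?groupX.
rewrite morphR ?groupX //= morphX //= commXg; last first.
  by apply/commute_sym/commgP; rewrite -!morphR //= coset_id.
by rewrite -morphR //= -morphX //= coset_id.
Qed.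

(** * The descending series of power subgroups *)

Section PowerfulMho.

Variables (p : nat) (gT : finGroupType) (U : {group gT}).
Hypotheses (p_pr : prime p) (pU : p.-group U) (pwU : powerful p U).

(** The claims feed each other: roots identify ['Mho^i.+1(U)] with ['Mho^1('Mho^i(U))], and
    powerfulness of ['Mho^i(U)] gives roots one level down. *)
Lemma powerful_Mho_ind (i : nat) :
  [/\ powerful p 'Mho^i(U),
      [~: 'Mho^i(U), U] \subset 'Mho^(pow_gap p)('Mho^i(U))
    & forall g, g \in 'Mho^i(U) -> exists2 u, u \in U & g = u ^+ (p ^ i)].
Proof.
elim: i => [|i [pwM sMU rootM]].
  by rewrite powerfulE /= Mho0 -powerfulE; split=> // g Ug; exists g.
have pM := pgroupS (Mho_sub i U) pU.
have eM : 'Mho^i.+1(U) = 'Mho^1('Mho^i(U)).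
  apply/eqP; rewrite eqEsubset -addn1 (sub_Mho_Mho i 1 pU) /=.
  apply: (Mho_sub_exp (p := p)) => // _ /rootM[u Uu ->].
  by rewrite -expgM -expnD Mho_exp.
have sM'U : [~: 'Mho^i.+1(U), U] \subset 'Mho^(pow_gap p)('Mho^i.+1(U)).
  by rewrite {1}eM (subset_trans (commg_Mho1 _ pU _ _)) ?gFnormal // -eM.
split=> //.
  by rewrite powerfulE (subset_trans _ sM'U) // commgS // Mho_sub.
move=> g; rewrite eM => /(powerful_Mho1_root p_pr pM pwM)[_ /rootM[u Uu ->] ->].
by exists u; rewrite // -expgM expnSr.
Qed.

Lemma Mho_root (i : nat) g :
  g \in 'Mho^i(U) -> exists2 u, u \in U & g = u ^+ (p ^ i).
Proof. by case: (powerful_Mho_ind i) => _ _; apply. Qed.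

Lemma Mho_Mho (i j : nat) : 'Mho^j('Mho^i(U)) = 'Mho^(i + j)(U).
Proof.
apply/eqP; rewrite eqEsubset (sub_Mho_Mho i j pU) andbT.
have pM := pgroupS (Mho_sub i U) pU.
apply: (Mho_sub_exp (p := p)) => // _ /Mho_root[u Uu ->].
by rewrite -expgM -expnD Mho_exp.
Qed.

Lemma exp_Mho (i j : nat) x :
  x \in 'Mho^i(U) -> x ^+ (p ^ j) \in 'Mho^(i + j)(U).
Proof. by case/Mho_root=> u Uu ->; rewrite -expgM -expnD Mho_exp. Qed.

Lemma Mho_root_Mho (i j : nat) g :
  g \in 'Mho^(i + j)(U) -> exists2 u, u \in 'Mho^i(U) & g = u ^+ (p ^ j).
Proof.
case/Mho_root=> u Uu ->; exists (u ^+ (p ^ i)); first exact: Mho_exp.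
by rewrite -expgM expnD.
Qed.

Lemma comm_Mho_l (i : nat) x y :
  x \in 'Mho^i(U) -> y \in U -> [~ x, y] \in 'Mho^(i + pow_gap p)(U).
Proof.
move=> Mx Uy; rewrite -Mho_Mho.
by case: (powerful_Mho_ind i) => _ sM _; rewrite (subsetP sM) ?mem_commg.
Qed.

(** Induction on [j] with [y = v ^+ p]: the p-th power of [[~ v, x]] is one level deeper, and so is
    [[~ [~ v, x], v]] because the gap is positive. *)
Lemma comm_Mho (i j : nat) x y :
    x \in 'Mho^i(U) -> y \in 'Mho^j(U) ->
  [~ x, y] \in 'Mho^(i + j + pow_gap p)(U).
Proof.
move=> Mx; elim: j y => [|j IH] y.
  by rewrite Mho0 addn0; apply: comm_Mho_l.
rewrite -addn1 => /Mho_root_Mho[v Mv ->].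
pose K := 'Mho^(i + (j + 1) + pow_gap p)(U)%G.
have nKU : U \subset 'N(K) by rewrite gFnorm.
have [Ux Uv] := (subsetP (Mho_sub _ _) _ Mx, subsetP (Mho_sub _ _) _ Mv).
have Mc : [~ v, x] \in 'Mho^(i + j + pow_gap p)(U).
  by rewrite -invg_comm groupV IH.
rewrite -invg_comm groupV expn1.
apply: (@commXg_mod _ K); try exact: (subsetP nKU).
  apply: subsetP (comm_Mho_l Mc Uv); apply: Mho_leq.
  by rewrite addnA addnAC leq_add2l pow_gap_gt0.
by have := exp_Mho 1 Mc; rewrite /K /= addnA (addnAC _ 1%N).
Qed.

End PowerfulMho.

(** * Commuting powers *)

(** The second clause is what the induction on e reads off in U / U_e: it puts p-th powers of
    commutators into U_e. *)
Definition powers_commute (p : nat) (gT : finGroupType) (U : {group gT}) n :=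
  forall x y, x \in U -> y \in U -> x ^+ (p ^ n.+1) = 1 -> y ^+ (p ^ n) = 1 ->
  (forall i j, i + j = n -> commute (x ^+ (p ^ i)) (y ^+ (p ^ j))) /\
  (forall i j, (i + j).+1 = n -> [~ x ^+ (p ^ i), y ^+ (p ^ j)] ^+ p = 1).

(** * The step from (i, j + 1) to (i + 1, j) for n = m + 1, given the law for m + 2 *)

Section PowersCommuteStep.

Variables (p : nat) (gT : finGroupType) (U : {group gT}) (e m : nat).
Hypotheses (p_pr : prime p) (pU : p.-group U) (pwU : powerful p U).
Hypothesis tU : 'Mho^e.+1(U) = 1.
Hypothesis pcU : powers_commute p U m.+2.

Let Mho_eq1 i g : e < i -> g \in 'Mho^i(U) -> g = 1.
Proof. by move=> lei /(subsetP (Mho_leq U lei)); rewrite tU => /set1P. Qed.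

Let sMU i := subsetP (Mho_sub i U).

(** A root [u] of [w] satisfies [u ^+ (p ^ m.+3) = 1], so this is the law for m + 2 at (m + 2,
    0). *)
Let Mho_p_commute w z :
    w \in 'Mho^m.+2(U) -> w ^+ p = 1 -> z \in U -> z ^+ (p ^ m.+2) = 1 ->
  commute w z.
Proof.
case/(Mho_root p_pr pU pwU)=> u Uu ->; rewrite -expgM -expnSr => u1 Uz z1.
by case: (pcU Uu Uz u1 z1) => /(_ m.+2 0) cuz _; apply: cuz; rewrite addn0.
Qed.

(** The law for m + 2 at (m + 1, 1), followed by a [p ^ m]-th power of the second argument. *)
Let pow_commute b c :
    b \in U -> c \in U -> b ^+ (p ^ m.+2) = 1 -> c ^+ (p ^ m.+2) = 1 ->
  commute (b ^+ (p ^ m.+1)) (c ^+ (p ^ m.+1)).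
Proof.
move=> Ub Uc b1 c1.
have b1' : b ^+ (p ^ m.+3) = 1 by rewrite expnSr expgM b1 expg1n.
case: (pcU Ub Uc b1' c1) => /(_ m.+1 1%N (addn1 _)) cbc _.
by have := commuteX (p ^ m) cbc; rewrite -expgM -expnD add1n.
Qed.

(* g is a root of the p-th power of a, taken so deep in U that it is almost
   central. *)
Lemma Mho_p_split a :
    a \in 'Mho^(m + pow_gap p)(U) -> a ^+ p \in 'Mho^e(U) ->
  exists b g, [/\ a = b * g, g \in U /\ b \in 'Mho^(m + pow_gap p)(U),
    b ^+ p = 1,
    forall u, u \in 'Mho^1(U) -> commute g u
    & forall u, u \in U ->
       [~ g, u] \in 'Mho^e(U) /\ (p = 2 -> commute g u)].
Proof.
move=> Ma Map; have g0 := pow_gap_gt0 p.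
(* If e is at most m + gap, then [a ^+ p] lies in U_(e+1) = 1 and [g = 1] will do. *)
have [le_e | lt_e] := leqP e (m + pow_gap p).
  exists a, 1; split; rewrite ?mulg1 ?group1 //.
  - by have := exp_Mho p_pr pU pwU 1 Ma; rewrite addn1 => /Mho_eq1; apply.
  - by move=> u _; apply/commute_sym/commute1.
  move=> u _.
  by rewrite comm1g group1; split=> // _; apply/commute_sym/commute1.
case: e lt_e tU Mho_eq1 Map => // e' lt_e tU' M1 Map.
(* The root [g] is taken in U_(e-1): its commutators with U_1 lie in U_(e+gap) = 1, and those with
   [U] in U_(e-1+gap), which is trivial if p = 2. *)
move: Map; rewrite -addn1 => /(Mho_root_Mho p_pr pU pwU)[g Mg def_g].
have Ma1 : a \in 'Mho^1(U).
  by apply: subsetP Ma; apply: Mho_leq; rewrite addn_gt0 g0 orbT.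
have cg u : u \in 'Mho^1(U) -> commute g u.
  move=> Mu; apply/commgP/eqP; apply: (M1 (e' + 1 + pow_gap p)).
    by rewrite addn1 addSn ltnS -addn1 leq_add2l.
  exact: comm_Mho.
have cag : commute a g^-1 by apply/commuteV/commute_sym/cg.
exists (a * g^-1), g; split=> //.
- by rewrite mulgKV.
- split; first exact: sMU Mg.
  by rewrite groupM // groupV; apply: subsetP Mg; apply: Mho_leq.
- by rewrite expgMn // def_g expgVn mulgV.
move=> u Uu; have Mgu := comm_Mho_l p_pr pU pwU Mg Uu; split.
  by apply: subsetP Mgu; apply: Mho_leq; rewrite -addn1 leq_add2l.
move=> p2; apply/commgP/eqP; apply: M1 Mgu.
by rewrite /pow_gap p2 addn2.
Qed.

(* The hypotheses of [commXg_bin] for the p-th power of a power of z, with a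
   vanishing error term. *)
Lemma commg_p_mod a z k (d := [~ a, z ^+ k]) :
    a \in 'Mho^(m + pow_gap p)(U) -> a ^+ p \in 'Mho^e(U) ->
    z \in U -> z ^+ (p ^ m.+2) = 1 ->
  [/\ commute a d, commute (z ^+ k) d & d ^+ 'C(p, 2) = 1].
Proof.
rewrite {}/d => Ma Map Uz z1.
have [b [g [-> [Ug Mb] b1 cg Tg]]] := Mho_p_split Ma Map.
have UZ : z ^+ k \in U by rewrite groupX.
have [Mgz cgz] := Tg _ UZ; have Ub := sMU Mb.
(* For p = 2 both [b] and [g] commute with [z ^+ k], so the commutator is trivial. *)
have [p2 | p'2] := eqVneq p 2.
  have Mb2 : b \in 'Mho^m.+2(U) by move: Mb; rewrite /pow_gap p2 addn2.
  have cbz := commuteX k (Mho_p_commute Mb2 b1 Uz z1).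
  have -> : [~ b * g, z ^+ k] = 1.
    apply/eqP/commgP/commute_sym.
    by apply: commuteM; apply: commute_sym => //; apply: cgz.
  by split; rewrite ?expg1n //; apply: commute1.
have g1 : pow_gap p = 1%N by rewrite /pow_gap (negPf p'2).
have Mb1 : b \in 'Mho^m.+1(U) by move: Mb; rewrite g1 addn1.
have Mho1 i : {subset 'Mho^i.+1(U) <= 'Mho^1(U)} by apply/subsetP/Mho_leq.
have T1 u t : t \in 'Mho^e(U) -> u \in U -> commute u t.
  move=> Mt Uu; apply/commute_sym/commgP/eqP/(@Mho_eq1 (e + pow_gap p)).
    by rewrite g1 addn1.
  exact: comm_Mho_l.
have [v Uv def_b] := Mho_root p_pr pU pwU Mb1.
have v1 : v ^+ (p ^ m.+2) = 1 by rewrite expnSr expgM -def_b.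
pose d := [~ b, z ^+ k]; have Ud : d \in U by rewrite groupR.
(* [b] and its conjugate by [z ^+ k] are both [p ^ m.+1]-th powers of elements killed by [p ^ m.+2],
   so they commute. *)
have cbd : commute b d.
  have cbbz : commute b (b ^ (z ^+ k)).
    rewrite def_b conjXg; apply: pow_commute; rewrite ?groupJ //.
    by rewrite -conjXg v1 conj1g.
  by apply: commuteM => //; apply: commuteV.
have d1 : d ^+ p = 1.
  have : (b * d) ^+ p = 1 by rewrite mulKVg -conjXg b1 conj1g.
  by rewrite expgMn // b1 mul1g.
have Md : d \in 'Mho^m.+2(U).
  by have := comm_Mho_l p_pr pU pwU Mb1 UZ; rewrite g1 addn1.
have cdz : commute d (z ^+ k) := commuteX k (Mho_p_commute Md d1 Uz z1).
have cgd : commute g d by apply: cg; apply: Mho1 Md.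
have -> : [~ b * g, z ^+ k] = d * [~ g, z ^+ k].
  by rewrite commMgJ -/d /conjg -cgd mulKg.
split.
- apply: commuteM; last by apply: T1 => //; apply: groupM.
  by apply/commute_sym/commuteM => //; apply: commute_sym.
- by apply: commuteM; [exact: commute_sym | exact: T1].
have t1 : [~ g, z ^+ k] ^+ p = 1.
  apply: (Mho_eq1 (ltnSn e)).
  by have := exp_Mho p_pr pU pwU 1 Mgz; rewrite addn1.
case/dvdnP: (dvdn_bin2 p_pr p'2) => q ->; rewrite mulnC expgM expgMn ?d1 ?t1 //.
  by rewrite mulg1 expg1n.
exact: T1.
Qed.

(** Without error terms, [[~ Y ^+ p, X] = [~ Y, X] ^+ p] and [[~ X ^+ p, Y] = [~ X, Y] ^+ p]. The
    first left side is trivial by assumption, hence so is the second. *)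
Lemma powers_commute_step x y i j :
    x \in U -> y \in U -> x ^+ (p ^ m.+2) = 1 -> y ^+ (p ^ m.+1) = 1 ->
    i + j = m -> [~ x ^+ (p ^ i), y ^+ (p ^ j)] ^+ p \in 'Mho^e(U) ->
    commute (x ^+ (p ^ i)) (y ^+ (p ^ j.+1)) ->
  [~ x ^+ (p ^ i), y ^+ (p ^ j)] ^+ p = 1
  /\ commute (x ^+ (p ^ i.+1)) (y ^+ (p ^ j)).
Proof.
move=> Ux Uy x1 y1 ijm; set X := x ^+ _; set Y := y ^+ (p ^ j) => Mc cXYp.
have Mxy : [~ X, Y] \in 'Mho^(m + pow_gap p)(U).
  by rewrite -ijm comm_Mho ?Mho_exp.
have y1' : y ^+ (p ^ m.+2) = 1 by rewrite expnSr expgM y1 expg1n.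
have c1 : [~ X, Y] ^+ p = 1.
  have [||//|//|cad cyd d1] := @commg_p_mod [~ Y, X] y (p ^ j).
  - by rewrite -invg_comm groupV.
  - by rewrite -invg_comm expgVn groupV.
  have := commXg_bin p cyd cad; rewrite d1 mulg1 -expgM -expnSr.
  move/commute_sym/commgP/eqP: cXYp => -> /esym.
  by rewrite -invg_comm expgVn => /(canRL (@invgK _)) ->; rewrite invg1.
split=> //.
have [//|//|//|//|cad cxd d1] := @commg_p_mod [~ X, Y] x (p ^ i).
by apply/commgP; rewrite expnSr expgM (commXg_bin _ cxd cad) d1 c1 mulg1.
Qed.

End PowersCommuteStep.

Lemma powers_commute_large (p : nat) (gT : finGroupType) (U : {group gT}) e n :
    prime p -> p.-group U -> powerful p U -> 'Mho^e(U) = 1 -> e <= n ->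
  powers_commute p U n.
Proof.
move=> p_pr pU pwU tU le_e x y Ux Uy _ _.
have M1 k g : e <= k -> g \in 'Mho^k(U) -> g = 1.
  by move=> lek /(subsetP (Mho_leq U lek)); rewrite tU => /set1P.
have Mc i j : [~ x ^+ (p ^ i), y ^+ (p ^ j)] \in 'Mho^(i + j + pow_gap p)(U).
  by rewrite comm_Mho ?Mho_exp.
have g0 := pow_gap_gt0 p.
split=> i j def_n.
  apply/commgP/eqP/(M1 _ _ _ (Mc i j)).
  by rewrite def_n (leq_trans le_e) ?leq_addr.
rewrite (M1 _ _ _ (Mc i j)) ?expg1n // (leq_trans le_e) // -def_n -addn1.
by rewrite leq_add2l.
Qed.

Lemma powerful_quotient (p : nat) (gT : finGroupType) (U K : {group gT}) :
  U \subset 'N(K) -> powerful p U -> powerful p (U / K).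
Proof.
move=> nKU; rewrite !powerfulE -quotientR // -quotient_Mho //.
exact: quotientS.
Qed.

Lemma ex_Mho_eq1 (p : nat) (gT : finGroupType) (U : {group gT}) :
  p.-group U -> exists e, 'Mho^e(U) = 1.
Proof.
move=> pU; exists (logn p #|U|); apply/trivgP/(Mho_sub_exp pU) => x Ux.
by rewrite -card_pgroup // expg_cardG // set11.
Qed.

Lemma powerful_powers_commute (p n : nat) (gT : finGroupType) (U : {group gT}) :
  prime p -> p.-group U -> powerful p U -> powers_commute p U n.
Proof.
move=> p_pr pU pwU.
have [e tU] := ex_Mho_eq1 pU.
elim: e gT U pU pwU tU n => [|e IHe] gT U pU pwU tU n.
  exact: powers_commute_large tU _.
(* The downward induction on n is an induction on [k], a bound for the distance up to e + 1. *)
have [k] : exists k, e.+1 <= n + k by exists e.+1; apply: leq_addl.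
elim: k n => [|k IHk] n le_e.
  by apply: powers_commute_large tU _; rewrite // -[n]addn0.
case: n le_e => [_ | m le_e].
  move=> x y _ _ _; rewrite expn0 expg1 => ->; split=> // i j _.
  by rewrite expg1n; apply: commute1.
have {IHk} pcU : powers_commute p U m.+2 by apply: IHk; rewrite addSnnS.
pose T := 'Mho^e(U)%G; have nTU : U \subset 'N(T) by rewrite gFnorm.
have pwUT := powerful_quotient nTU pwU.
have tUT : 'Mho^e(U / T) = 1.
  by rewrite -quotient_Mho // trivg_quotient.
have pcUT := IHe _ _ (quotient_pgroup T pU) pwUT tUT m.+1.
move=> x y Ux Uy x1 y1.
have step := powers_commute_step p_pr pU pwU tU pcU Ux Uy x1 y1.
have [Nx Ny] := (subsetP nTU x Ux, subsetP nTU y Uy).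
have Tc i j : i + j = m -> [~ x ^+ (p ^ i), y ^+ (p ^ j)] ^+ p \in T.
  move=> ijm; apply: coset_idr; first by rewrite groupX ?groupR ?groupX.
  rewrite morphX ?groupR ?groupX // morphR ?groupX // !morphX //=.
  have xb1 : coset T x ^+ (p ^ m.+2) = 1 by rewrite -morphX // x1 morph1.
  have yb1 : coset T y ^+ (p ^ m.+1) = 1 by rewrite -morphX // y1 morph1.
  have [_ ->//] := pcUT _ _ (mem_quotient T Ux) (mem_quotient T Uy) xb1 yb1.
  by rewrite ijm.
have cxy i j : i + j = m.+1 -> commute (x ^+ (p ^ i)) (y ^+ (p ^ j)).
  elim: i j => [|i IHi] j ijm.
    by rewrite -ijm add0n in y1; rewrite y1; apply: commute1.
  have ijm1 : i + j = m by apply: succn_inj; rewrite -ijm addSn.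
  have cXY : commute (x ^+ (p ^ i)) (y ^+ (p ^ j.+1)).
    by apply: IHi; rewrite addnS -addSn.
  by case: (step _ _ ijm1 (Tc i j ijm1) cXY).
split=> // i j [ijm].
have cXY : commute (x ^+ (p ^ i)) (y ^+ (p ^ j.+1)).
  by apply: cxy; rewrite addnS ijm.
by case: (step _ _ ijm (Tc i j ijm) cXY).
Qed.

(** * Abelian subgroups from commuting powers *)

(** For roots [u], [v] of two generators, the law for m + k at (m, k) makes [u ^+ (p ^ m)] commute
    with [v ^+ (p ^ k)], hence with its power [v ^+ (p ^ m)]. *)
Lemma abelian_Ohm_Mho (p k m : nat) (gT : finGroupType) (U : {group gT}) :
    prime p -> p.-group U -> powerful p U -> k <= m ->
  abelian 'Ohm_k('Mho^m(U)).
Proof.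
move=> p_pr pU pwU lekm; have pM := pgroupS (Mho_sub m U) pU.
rewrite (OhmE k pM) abelian_gen; apply/centsP.
move=> x /LdivP[/(Mho_root p_pr pU pwU)[u Uu ->] x1].
move=> y /LdivP[/(Mho_root p_pr pU pwU)[v Uv ->] y1].
move: x1 y1; rewrite -!expgM -!expnD => x1 y1.
have x1' : u ^+ (p ^ (m + k).+1) = 1 by rewrite expnSr expgM x1 expg1n.
have [/(_ m k erefl) cuv _] :=
  powerful_powers_commute p_pr pU pwU Uu Uv x1' y1.
by have := commuteX (p ^ (m - k)) cuv; rewrite -expgM -expnD subnKC.
Qed.

Lemma card_Mho_le (p m : nat) (gT : finGroupType) (U : {group gT}) :
    prime p -> p.-group U -> powerful p U -> 0 < m ->
  #|'Mho^m(U)| <= #|'Ohm_1('Mho^m(U))| * #|'Mho^m.+1(U)|.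
Proof.
move=> p_pr pU pwU m_gt0.
have [e tU] := ex_Mho_eq1 pU.
elim: e gT U pU pwU tU => [|e IHe] gT U pU pwU tU.
  by rewrite Mho0 in tU; rewrite !tU !(Mho1, cards1) muln_gt0 !cardG_gt0.
set V := 'Mho^m(U)%G; have pV : p.-group V := pgroupS (Mho_sub m U) pU.
have [le_e | lt_e] := leqP e.+1 m.+1.
  have tV : 'Mho^1(V) == 1.
    by rewrite -subG1 /= (Mho_Mho p_pr pU pwU) addn1 -tU Mho_leq.
  by rewrite (eqP (trivg_Mho tV)) leq_pmulr ?cardG_gt0.
case: e lt_e IHe tU => // e; rewrite !ltnS => le_m IHe tU.
pose T := 'Mho^e.+1(U)%G; pose G := 'Mho^e(U)%G.
have nTU : U \subset 'N(T) by rewrite gFnorm.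
have nTV := subset_trans (Mho_sub m U) nTU.
have sTV : T \subset V by apply: Mho_leq; apply: leqW.
have sGV : G \subset V by apply: Mho_leq.
have sTV1 : T \subset 'Mho^m.+1(U) by apply: Mho_leq.
have eT : 'Mho^1(G) = T by rewrite /= (Mho_Mho p_pr pU pwU) addn1.
(* [U_e, U_m] lies in U_(e+m+gap), hence in U_(e+2) = 1, since m and the gap are positive. *)
have cGV : G \subset 'C(V).
  apply/centsP=> g Gg v Vv; apply/commgP/eqP/set1P.
  have <- : 'Mho^e.+2(U) = [set 1] := tU.
  apply: subsetP (comm_Mho p_pr pU pwU Gg Vv); apply: Mho_leq.
  rewrite -addnA -[e.+2]addn2 leq_add2l.
  exact: (leq_add m_gt0 (pow_gap_gt0 p)).
have cGG : abelian G := subset_trans cGV (centS sGV).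
set O := 'Ohm_1(V)%G; have cOO : abelian O := abelian_Ohm_Mho p_pr pU pwU m_gt0.
have pVT := quotient_pgroup T pV; have pwUT := powerful_quotient nTU pwU.
have pUT := quotient_pgroup T pU.
have eVT : 'Mho^m(U / T) = V / T by rewrite -quotient_Mho.
have eV1T : 'Mho^m.+1(U / T) = 'Mho^m.+1(U) / T by rewrite -quotient_Mho.
have cVT : abelian 'Ohm_1(V / T) by rewrite -eVT (abelian_Ohm_Mho p_pr).
(* If [v ^+ p] is in [T], it equals [g ^+ p] with [g] in [G], which centralises [V]; so [v * g^-1]
   has order dividing p. *)
have sPOG : coset T @*^-1 'Ohm_1(V / T) \subset O * G.
  apply/subsetP=> v /morphpreP[Nv]; rewrite (OhmEabelian pVT cVT).
  case/LdivP=> /morphimP[w Nw Vw ewv]; rewrite expn1 => vp1.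
  have Vv : v \in V.
    by rewrite -(mulKVg w v) groupM // (subsetP sTV) // cosetM_id // -ewv.
  have : v ^+ p \in T by apply: coset_idr; rewrite ?groupX // morphX.
  rewrite /T /= -addn1 => /(Mho_root_Mho p_pr pU pwU)[g Gg def_vp].
  have cvg : commute v g^-1.
    by apply/commuteV/commute_sym; apply: (centsP cGV).
  rewrite -(mulgKV g v) mem_mulg // (OhmE 1 pV) mem_gen //.
  apply/LdivP; split; first by rewrite groupM ?groupV // (subsetP sGV).
  by rewrite expgMn // expgVn expn1 def_vp expn1 mulgV.
(* [O] and [G] share ['Ohm_1(G)], and the abelian group [G] has order [#|'Ohm_1(G)| * #|T|]; so
   [O * G] has at most [#|O| * #|T|] elements. *)
have leOT : #|'Ohm_1(V / T)| <= #|O|.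
  have := subset_leq_card sPOG; rewrite card_cosetpre => leTO.
  have leOG : #|O * G| * #|'Ohm_1(G)| <= #|O| * #|G|.
    rewrite mul_cardG leq_mul2l subset_leq_card ?orbT //.
    by rewrite subsetI OhmS // Ohm_sub.
  rewrite -(mul_card_Ohm_Mho_abelian 1 cGG) eT in leOG.
  rewrite -(leq_pmul2l (cardG_gt0 T)) (leq_trans leTO) //.
  rewrite -(leq_pmul2r (cardG_gt0 'Ohm_1(G))) (leq_trans leOG) //.
  by rewrite (mulnC #|T|) -mulnA (mulnC #|T|).
have tUT : 'Mho^e.+1(U / T) = 1 by rewrite -quotient_Mho // trivg_quotient.
have := IHe _ _ pUT pwUT tUT; rewrite eVT eV1T => leVT.
rewrite -(Lagrange sTV) -(Lagrange sTV1) -!card_quotient //; last first.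
  exact: subset_trans (Mho_sub _ U) nTU.
by rewrite mulnCA leq_mul2l (leq_trans leVT) ?orbT // leq_mul2r leOT orbT.
Qed.

(** * Homocyclic groups *)

Lemma prodg_commM (gT : finGroupType) (A : {group gT}) (I : finType)
    (a b : I -> gT) :
    abelian A -> (forall i, a i \in A) -> (forall i, b i \in A) ->
  \prod_i (a i * b i) = \prod_i a i * \prod_i b i.
Proof.
move=> cAA Aa Ab.
pose P (u v w : gT) := [/\ v \in A, w \in A & u = v * w].
suffices [] : P (\prod_i (a i * b i)) (\prod_i a i) (\prod_i b i) by [].
apply: (big_ind3 P) => [|u1 u2 u3 v1 v2 v3 [A2 A3 ->] [B2 B3 ->]|i _].
- by split; rewrite ?group1 ?mulg1.
- split; rewrite ?groupM // -!mulgA; congr (_ * _); rewrite !mulgA.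
  by congr (_ * _); apply: (centsP cAA).
by split.
Qed.

(** The isomorphism sends an exponent vector to the product of the powers of the [x i]; uniqueness
    of the decomposition of 1 makes it injective. *)
Lemma bigdprod_isog_cyclic_power (gT : finGroupType) (k d : nat)
    (x : 'I_d -> gT) (K : {group gT}) :
    1 < k -> abelian K -> (forall i, #[x i] = k) ->
    \big[dprod/1]_i <[x i]> = K ->
  K \isog cyclic_power k d.
Proof.
case: k => [|[|k]] // _ cKK ox defK; rewrite isog_sym.
have x1 i : x i ^+ k.+2 = 1 by rewrite -(ox i) expg_order.
have Kx i (n : nat) : x i ^+ n \in K.
  rewrite groupX // -[_ \in K]/(_ \in gval K) -(bigdprodWY defK) mem_gen //.
  by apply/bigcupP; exists i; rewrite ?cycle_id.
pose psi (t : {dffun 'I_d -> 'Z_k.+2}) := \prod_i x i ^+ (t i : nat).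
have psiM : {in cyclic_power k.+2 d &, {morph psi : s t / s * t}}.
  move=> s t _ _; rewrite /psi -(prodg_commM cKK) //; apply: eq_bigr => i _.
  by rewrite -expgD dffunM /= expg_mod.
have inZ t : t \in cyclic_power k.+2 d.
  by apply/setXnP => i; rewrite /Zp /= inE.
apply/isogP; exists (Morphism psiM).
  apply/subsetP=> t /morphpreP[_ /set1P/= psi1]; apply/set1P/ffunP=> i.
  have [c [_ _ cP]] := mem_bigdprod defK (group1 K).
  have c1 j : 1 = c j by apply: (cP (fun=> 1)) => //; rewrite big1.
  have : x i ^+ (t i : nat) = c i.
    by apply: (cP (fun j => x j ^+ (t j : nat))) => // j _; apply: mem_cycle.
  rewrite -c1 => /eqP; rewrite -order_dvdn ox => dvd_t; apply: val_inj.
  rewrite ffunE /=; apply/eqP; rewrite eqn0Ngt; apply: contraL dvd_t => t_gt0.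
  by rewrite gtnNdvd // ltn_ord.
apply/setP=> g; apply/morphimP/idP=> [[t _ _ ->] | Kg] /=.
  by apply: group_prod.
have [c [xc -> _]] := mem_bigdprod defK Kg.
have /fin_all_exists[n cn] i : exists n : 'Z_k.+2, c i = x i ^+ n.
  have /cycleP[n ->] := xc i isT; exists (inZp n).
  by rewrite /= expg_mod.
exists (finfun n : {dffun 'I_d -> 'Z_k.+2}); rewrite ?inZ //=.
by apply: eq_bigr => i _; rewrite ffunE cn.
Qed.

Lemma abelian_cyclic_power (p f d : nat) (gT : finGroupType) (A : {group gT}) :
    prime p -> p.-group A -> abelian A -> 'Mho^f.+1(A) = 1 ->
    p ^ d <= #|'Mho^f(A)| ->
  exists2 H : {group gT}, H \subset A & H \isog cyclic_power (p ^ f.+1) d.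
Proof.
move=> p_pr pA cAA tA lt_d.
have [b defA _] := abelian_structure cAA.
pose q := [pred x : gT | f < logn p #[x]].
have le_d : d <= count q b.
  (* The number of factors of order above [p ^ f] is the p-logarithm of the index of ['Ohm_f(A)] in
     [A], and this index is [#|'Mho^f(A)|]. *)
  rewrite (count_logn_dprod_cycle p f defA).
  rewrite (eqP (trivg_Mho (introT eqP tA))) -divgS ?Ohm_sub //.
  rewrite -(mul_card_Ohm_Mho_abelian f cAA) mulKn ?cardG_gt0 //.
  have /p_natP[k ek] : p.-nat #|'Mho^f(A)| by apply: pgroupS pA; apply: Mho_sub.
  by move: lt_d; rewrite ek pfactorK // leq_exp2l // prime_gt1.
pose c := take d (filter q b).
(* Reordering [b] as [c ++ r] splits off the product of d large factors as a direct factor. *)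
pose r := drop d (filter q b) ++ filter (predC q) b.
have size_c : size c = d by rewrite size_takel // size_filter.
have perm_b : perm_eq b (c ++ r).
  by rewrite catA cat_take_drop perm_sym (permEl (perm_filterC q b)).
have := defA; rewrite (perm_big _ perm_b) big_cat /=.
case/dprodP=> [[K R defK defR] defKR _ _].
have sKA : K \subset A by rewrite -defKR defK defR mulG_subl.
have cKK := abelianS sKA cAA.
exists K => //.
have defK' : \big[dprod/1]_(i < d) <[nth 1 c i]> = K.
  by rewrite -defK [RHS](big_nth 1) size_c big_mkord.
apply: (bigdprod_isog_cyclic_power _ cKK _ defK').
  by rewrite -(exp1n f.+1) ltn_exp2r // prime_gt1.
move=> i; set x := nth 1 c i.
have cx : x \in c by rewrite mem_nth // size_c.
have Ax : x \in A.
  apply: subsetP sKA _ _; have := bigdprodWY defK'.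
  move/(congr1 (fun B : {set gT} => x \in B)) <-; rewrite mem_gen //.
  by apply/bigcupP; exists i; rewrite ?cycle_id.
have qx : q x by have := mem_take cx; rewrite mem_filter => /andP[].
have /(dvdn_pfactor _ _ p_pr)[n le_n ox] : #[x] %| p ^ f.+1.
  by rewrite order_dvdn -in_set1 -[[set 1]]tA (Mho_exp f.+1 pA).
rewrite ox; congr (p ^ _)%N; apply/eqP; rewrite eqn_leq le_n.
by move: qx; rewrite /= ox pfactorK.
Qed.

(** * Power subgroups of homocyclic groups *)

Lemma dffunX (I : finType) (gT : I -> finGroupType) (i : I) n
    (t : {dffun forall i, gT i}) :
  (t ^+ n) i = t i ^+ n.
Proof. exact: (morphX (dffun_morphism gT i) n (in_setT t)). Qed.

Lemma pgroup_cyclic_power (p n d : nat) :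
  prime p -> p.-group (cyclic_power (p ^ n) d).
Proof.
move=> p_pr; rewrite /pgroup cardsXn (eq_bigr (fun=> p ^ n)%N) => [|i _].
  by rewrite prod_nat_const pnatX pnatX pnat_id.
by rewrite card_Zp // expn_gt0 prime_gt0.
Qed.

(** The vectors with entries [s i * p ^ n], where [s i < p], are distinct: no entry reaches the
    modulus [p ^ n.+1]. *)
Lemma card_Mho_cyclic_power (p n d : nat) : prime p ->
  p ^ d <= #|'Mho^n(cyclic_power (p ^ n.+1) d)|.
Proof.
move=> p_pr; have p_gt1 := prime_gt1 p_pr.
have k_gt1 : 1 < p ^ n.+1 by rewrite -(exp1n n.+1) ltn_exp2r.
have pC := pgroup_cyclic_power n.+1 d p_pr.
pose h (s : {ffun 'I_d -> 'I_p}) : {dffun 'I_d -> 'Z_(p ^ n.+1)} :=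
  [ffun i => inZp (s i)].
have inj_h : injective (fun s => h s ^+ (p ^ n)).
  have powE s i : (h s ^+ (p ^ n)) i = (s i * p ^ n)%N :> nat.
    rewrite dffunX ffunE Zp_expg /= Zp_cast // modnMml modn_small // expnS.
    by rewrite ltn_pmul2r ?expn_gt0 ?prime_gt0.
  move=> s t est; apply/ffunP=> i; apply/val_inj/eqP.
  rewrite -(@eqn_pmul2r (p ^ n)) ?expn_gt0 ?prime_gt0 //.
  by rewrite -!powE est.
have <- : #|{ffun 'I_d -> 'I_p}| = (p ^ d)%N by rewrite card_ffun !card_ord.
rewrite -(card_imset _ inj_h).
apply/subset_leq_card/subsetP=> _ /imsetP[s _ ->]; apply: (Mho_exp n pC).
by apply/setXnP=> i; rewrite /Zp k_gt1 inE.
Qed.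

Lemma Mho_cyclic_power (p n d : nat) :
  prime p -> 'Mho^n(cyclic_power (p ^ n) d) = 1.
Proof.
move=> p_pr; have pC := pgroup_cyclic_power n d p_pr.
apply/trivgP/(Mho_sub_exp pC) => t /setXnP Zt.
apply/set1P/ffunP=> i; rewrite dffunX ffunE.
have pn_gt0 : 0 < p ^ n by rewrite expn_gt0 prime_gt0.
by rewrite -[X in _ ^+ X](card_Zp pn_gt0) expg_cardG.
Qed.

(** * From the homocyclic image to the homocyclic subgroup *)

(** The kernel contains U_(n+1), so the image of U_n has order at most |U_n : U_(n+1)|, which
    [card_Mho_le] bounds. *)
Lemma card_Ohm1_Mho (p n : nat) (gT rT : finGroupType) (U : {group gT})
    (phi : {morphism U >-> rT}) :
    prime p -> p.-group U -> powerful p U -> 0 < n ->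
    'Mho^n.+1(phi @* U) = 1 ->
  #|'Mho^n(phi @* U)| <= #|'Ohm_1('Mho^n(U))|.
Proof.
move=> p_pr pU pwU n_gt0 tC; rewrite -morphim_Mho //.
have sVU : 'Mho^n(U) \subset U := Mho_sub n U.
rewrite -(leq_pmul2r (cardG_gt0 'Mho^n.+1(U))).
apply: leq_trans (card_Mho_le p_pr pU pwU n_gt0).
rewrite card_morphim (setIidPr sVU).
rewrite -[#|'Mho^n(U)|](LagrangeI 'Mho^n(U)%G ('ker phi)%G) mulnC leq_mul2r.
rewrite subset_leq_card ?orbT // subsetI Mho_leq //=.
by rewrite -sub_morphim_pre ?Mho_sub // morphim_Mho // tC.
Qed.

Theorem theorem3p1 (p : nat) (gT : finGroupType) (U : {group gT}) (d f : nat)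
    (p_prime : prime p) (pU : p.-group U) (powU : powerful p U)
    (d_ge1 : (1 <= d)%N) (f_ge1 : (1 <= f)%N)
    (surj : exists phi : {morphism U >-> {dffun 'I_d -> 'Z_(p ^ (2 * f))%N}},
       phi @* U = cyclic_power (p ^ (2 * f))%N d) :
  exists2 H : {group gT}, H \subset U & H \isog cyclic_power (p ^ f)%N d.
Proof.
case: f f_ge1 surj => // f _ [phi def_phi].
set A := 'Ohm_f.+1('Mho^f.+1(U))%G.
have sAU : A \subset U := subset_trans (Ohm_sub _ _) (Mho_sub _ _).
have cAA : abelian A := abelian_Ohm_Mho p_prime pU powU (leqnn _).
have pA := pgroupS sAU pU; have pM := pgroupS (Mho_sub f.+1 U) pU.
have eA : A = 'Ldiv_(p ^ f.+1)('Mho^f.+1(U)) :> {set gT} := OhmEabelian pM cAA.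
have tA : 'Mho^f.+1(A) = 1.
  apply/trivgP/(Mho_sub_exp pA) => x; rewrite eA => /LdivP[_ ->].
  exact: group1.
(* With [f.+1] in the role of f, the exponent 2f is n + 1 for n = [f.+1 + f], the last level at
   which the image is nontrivial. *)
have def_n : (2 * f.+1)%N = (f.+1 + f).+1 by rewrite mul2n -addnn addnS.
have le_d : p ^ d <= #|'Mho^f(A)|.
  rewrite def_n in phi def_phi *.
  have tC : 'Mho^(f.+1 + f).+1(phi @* U) = 1.
    by rewrite def_phi Mho_cyclic_power.
  have := card_Ohm1_Mho p_prime pU powU _ tC; rewrite def_phi => /(_ isT) leO.
  apply: leq_trans (card_Mho_cyclic_power _ _ p_prime) (leq_trans leO _).
  have pV := pgroupS (Mho_sub (f.+1 + f) U) pU.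
  (* An element of order dividing p in U_n is [w ^+ (p ^ f)] with [w] in U_(f+1) and
     [w ^+ (p ^ f.+1) = 1], so [w] is in [A]. *)
  rewrite subset_leq_card // (OhmE 1 pV) gen_subG; apply/subsetP=> z.
  case/LdivP=> /(Mho_root_Mho p_prime pU powU)[w Mw ->].
  rewrite -expgM -expnD addn1 => w1; apply: (Mho_exp f pA).
  by rewrite eA; apply/LdivP.
have [H sHA isoH] := abelian_cyclic_power p_prime pA cAA tA le_d.
by exists H => //; apply: subset_trans sHA sAU.
Qed.
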